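(* Let $R$ be an absolutely continuous random variable with cdf $F_R$ and pdf $f_R$, and let $c_1,c_2,\gamma>0$. Suppose $X$ and $Y$ are independent Weibull-$R(c_1,\gamma)$ and Weibull-$R(c_2,\gamma)$ random variables, respectively (with the same baseline $R$ and the same $\gamma$). Then the reliability parameter $\mathcal{R}=P(X>Y)$ is given by $$\mathcal{R}=1-\sum_{k=0}^{\infty}\frac{(-1)^k}{k!}\,\Gamma\left(\frac{k c_2}{c_1}+1\right).$$
   Context: Weibull-$R(c,\gamma)$ family: for an absolutely continuous random variable $R$ with cdf $F_R$ and pdf $f_R$, and $c,\gamma>0$, a random variable is Weibull-$R(c,\gamma)$ if it has cdf $$F(x)=1-\exp\left\{-\left[\frac{-\log(1-F_R(x))}{\gamma}\right]^c\right\}$$ and pdf $$f(x)=\frac{c}{\gamma}\,\frac{f_R(x)}{1-F_R(x)}\left[\frac{-\log(1-F_R(x))}{\gamma}\right]^{c-1}\exp\left\{-\left[\frac{-\log(1-F_R(x))}{\gamma}\right]^c\right\}.$$ $\Gamma(\cdot)$ denotes the Euler gamma function.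
   Formalization: The identity is asserted only when the series converges, which is proved for c_2 < c_1; for c_2 ≥ c_1 the series diverges (for c_1 = c_2 its terms are (-1)^k, while P(X>Y) = 1/2), so the formula is undefined there. *)

(* Defs.v *)
(* MathComp-Analysis *)
From HB Require Import structures.
From mathcomp Require Import all_boot all_order all_algebra.
From mathcomp Require Import all_classical all_reals all_analysis.
From mathcomp Require Import measurable_realfun.

Set Implicit Arguments.
Unset Strict Implicit.
Unset Printing Implicit Defensive.

Import Order.TTheory GRing.Theory Num.Theory.
Import numFieldNormedType.Exports.

Local Open Scope classical_set_scope.
Local Open Scope ring_scope.

Definition Gamma {K : realType} (a : K) : K :=
  \int[lebesgue_measure]_(t in `]0, +oo[) (t `^ (a - 1) * expR (- t)).

Definition has_pdf d (T : measurableType d) (K : realType) (P : probability T K)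
    (X : {RV P >-> K}) (f : K -> \bar K) : Prop :=
  [/\ measurable_fun [set: K] f,
      (forall x, 0 <= f x)%E
    & forall A : set K, measurable A ->
        distribution P X A = (\int[lebesgue_measure]_(x in A) f x)%E].

Definition independent_RV d (T : measurableType d) (K : realType)
    (P : probability T K) (X Y : {RV P >-> K}) : Prop :=
  forall A B : set K, measurable A -> measurable B ->
    P (X @^-1` A `&` Y @^-1` B) = (P (X @^-1` A) * P (Y @^-1` B))%E.

Section weibullR.
Context {K : realType}.
Variables (c g : K).
Local Open Scope ereal_scope.

(* The formulas are written in the extended reals so that
   - log (1 - F_R x) = +oo where F_R x = 1; the real ln has ln 0 = 0, which
   would make the Weibull-R cdf vanish to the right of the support of R. *)
Definition cumhaz (FR : K -> \bar K) (x : K) : \bar K := - lne (1 - FR x).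

Definition weibullR_cdf (FR : K -> \bar K) (x : K) : \bar K :=
  1 - expeR (- poweR (cumhaz FR x / g%:E) c).

(* Where F_R x is 0 or 1, the factors other than f_R x may be conventional
   values such as 0^(c - 1) or 1/0; as f_R vanishes almost everywhere there,
   this affects the density only on a null set. *)
Definition weibullR_pdf (FR : K -> \bar K) (fR : K -> K) (x : K) : \bar K :=
  (c / g)%:E * ((fR x)%:E / (1 - FR x))
  * poweR (cumhaz FR x / g%:E) (c - 1)
  * expeR (- poweR (cumhaz FR x / g%:E) c).

Definition is_weibullR d (T : measurableType d) (P : probability T K)
    (X : {RV P >-> K}) (FR : K -> \bar K) (fR : K -> K) : Prop :=
  (forall x, cdf X x = weibullR_cdf FR x) /\ has_pdf X (weibullR_pdf FR fR).

End weibullR.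

Definition reliability_term {K : realType} (c1 c2 : K) (k : nat) : K :=
  (-1) ^+ k / k`!%:R * Gamma (k%:R * c2 / c1 + 1).

(* Main.v *)
Require Import Defs.
From HB Require Import structures.
From mathcomp Require Import all_boot all_order all_algebra.
From mathcomp Require Import all_classical all_reals all_analysis.
From mathcomp Require Import measurable_realfun.
From mathcomp Require Import ring lra.
Set Implicit Arguments.
Unset Strict Implicit.
Unset Printing Implicit Defensive.
Import Order.TTheory GRing.Theory Num.Theory.
Import numFieldNormedType.Exports.
Local Open Scope classical_set_scope.
Local Open Scope ring_scope.

(** Put a = c2 / c1 and let S_X, S_Y be the survival functions of X and Y.
    With h = - ln (1 - F_R) / gamma they are exp (- h ^ c1) and
    exp (- h ^ c2), so that S_Y = exp (- (- ln S_X) ^ a): the baseline and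
    gamma disappear from the comparison ([weibullR_survival_power]).  By
    independence P(X <= Y) is the expectation of S_Y(X)
    ([probability_le_ccdf]), that is, of exp (- Z ^ a) with
    Z = - ln S_X(X).  As X has no atom, F_X(X) is uniform, hence Z is
    exponential of rate 1 and P(X <= Y) is the integral Q of
    exp (- t ^ a) exp (- t) over t > 0.  The last step is done by comparing X
    with an exponential variable: the integral transform of every atomless
    variable has the same law ([integral_cdf_transform]), and for the
    exponential variable the expectation is Q.

    It remains to see that Q is the sum of the series, which is the expansion
    of exp (- t ^ a) in powers of t ^ a integrated term by term.  Interchanging
    the sum and the integral is not justified by absolute convergence, since
    the series is only assumed to converge.  But the partial sums of
    exp (- x), x >= 0, lie alternately above and below exp (- x)
    ([alternating_expRN]); hence the partial sums of the Gamma series lie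
    alternately above and below Q ([alternating_Gamma_series]), and as soon as
    they converge, their limit is Q ([lim_Gamma_series]).

    When a < 1 the same computation with all signs positive bounds the partial
    sums of the absolute values by the integral of exp (t ^ a - t), which is
    finite, so the series converges absolutely ([cvg_Gamma_series]). *)

(** * Elementary bounds on exponentials and powers *)

Section exp_bounds.
Context {K : realType}.
Implicit Types (t s a : K) (n k : nat).

Lemma is_derive_sum_exp_coeffN n t :
  is_derive t 1 (fun x : K => \sum_(k < n.+1) (- x) ^+ k / k`!%:R)
    (- \sum_(k < n) (- t) ^+ k / k`!%:R).
Proof.
elim: n => [|n IH].
  rewrite big_ord0 oppr0.
  have -> : (fun x : K => \sum_(k < 1) (- x) ^+ k / k`!%:R) = cst 1.
    by apply/funext => x; rewrite big_ord1 expr0 fact0 divr1.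
  exact: is_derive_cst.
have -> : (fun x : K => \sum_(k < n.+2) (- x) ^+ k / k`!%:R) =
   (fun x => \sum_(k < n.+1) (- x) ^+ k / k`!%:R) +
   (fun x => (- x) ^+ n.+1 / n.+1`!%:R).
  by apply/funext => x; rewrite big_ord_recr.
rewrite big_ord_recr/= opprD; apply: is_deriveD.
have hX (y : K) : is_derive y 1 (fun x : K => x ^+ n.+1) (n.+1%:R * y ^+ n).
  apply: DeriveDef; first exact: exprn_derivable.
  by rewrite exp_derive; exact: mulr1.
have hN : is_derive t 1 (-%R : K -> K) (-1) by exact: is_deriveN.
have /(is_deriveZ (n.+1`!%:R)^-1) h := is_derive1_comp (hX (- t)) hN.
have -> : (fun x : K => (- x) ^+ n.+1 / n.+1`!%:R) =
    (n.+1`!%:R)^-1 \*: ((fun x : K => x ^+ n.+1) \o -%R).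
  by apply/funext => x; exact: mulrC.
apply: (is_derive_eq h).
rewrite mulrN1 scalerN; congr (- _).
rewrite factS natrM invfM.
(* Scaling in K seen as a module over itself is multiplication. *)
change ((n.+1%:R^-1 * n`!%:R^-1) * (n.+1%:R * (- t) ^+ n) =
  (- t) ^+ n / n`!%:R).
by rewrite mulrACA mulVf ?mul1r 1?mulrC// pnatr_eq0.
Qed.

(** The (n+1)-st signed remainder vanishes at 0 and its derivative is the n-th
    one, so nonnegativity passes from n to n + 1. *)
Lemma alternating_expRN n t : 0 <= t ->
  0 <= (-1) ^+ n * (expR (- t) - \sum_(k < n) (- t) ^+ k / k`!%:R).
Proof.
elim: n t => [|n IH] t t0.
  by rewrite big_ord0 subr0 mul1r expR_ge0.
pose f x : K :=
  (-1) ^+ n.+1 * (expR (- x) - \sum_(k < n.+1) (- x) ^+ k / k`!%:R).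
have df (x : K) : is_derive x 1 f
    ((-1) ^+ n * (expR (- x) - \sum_(k < n) (- x) ^+ k / k`!%:R)).
  have h := is_derive_sum_exp_coeffN n x.
  have hN : is_derive x 1 (-%R : K -> K) (-1) by exact: is_deriveN.
  have hE := is_derive1_comp (is_derive_expR (- x)) hN.
  have /(is_deriveZ ((-1) ^+ n.+1)) h' := is_deriveB hE h.
  apply: (is_derive_eq h').
  change ((-1) ^+ n.+1 *
      (expR (- x) * -1 - - \sum_(k < n) (- x) ^+ k / k`!%:R) =
    (-1) ^+ n * (expR (- x) - \sum_(k < n) (- x) ^+ k / k`!%:R)).
  by rewrite exprS; ring.
have f0 : f 0 = 0.
  rewrite /f oppr0 expR0 big_ord_recl expr0 fact0 divr1.
  rewrite big1 ?addr0 ?subrr ?mulr0//.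
  by move=> i _; rewrite /= expr0n mul0r.
rewrite -/(f t) -f0.
have der x : derivable f x 1 by have [] := df x.
apply: (@ger0_derive1_le_cc _ f 0 t) => //.
- move=> x; rewrite in_itv/= => /andP[x0 _].
  by rewrite derive1E (@derive_val _ _ _ _ _ _ _ (df x)) IH// ltW.
- apply: continuous_subspaceT => x.
  exact/differentiable_continuous/derivable1_diffP.
- by rewrite in_itv/= lexx.
- by rewrite in_itv/= lexx t0.
Qed.

(** From ln x <= x - 1 at x = t / (2 (s + 1)); using s + 1 rather than s in the
    constant keeps the case s = 0 uniform. *)
Lemma powR_le_expR s t : 0 <= s -> 0 < t ->
  t `^ s <= (2 * (s + 1)) `^ s * expR (t / 2).
Proof.
move=> s0 t0.
have s1 : 0 < 2 * (s + 1) by lra.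
rewrite {2}/powR gt_eqF// -expRD {1}/powR gt_eqF// ler_expR.
have : ln (t / (2 * (s + 1))) <= t / (2 * (s + 1)) - 1.
  rewrite -[X in ln X](subrK 1) addrC; apply: le_ln1Dx.
  by rewrite ltrBDr addNr divr_gt0.
rewrite lnM ?posrE ?invr_gt0// lnV ?posrE// => h.
have : s * (ln t - ln (2 * (s + 1))) <= s * (t / (2 * (s + 1)) - 1).
  by rewrite ler_wpM2l.
have : s * (t / (2 * (s + 1))) <= t / 2.
  have -> : s * (t / (2 * (s + 1))) = t / 2 * (s / (s + 1)) by field; lra.
  by rewrite ler_piMr ?divr_ge0 ?ler_pdivrMr; lra.
by rewrite !mulrBr; lra.
Qed.

(** The constant 2 ^ (1 / (1 - a)) is the point where t ^ a = t / 2: beyond it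
    the linear term dominates, before it monotonicity suffices. *)
Lemma powR_le_half a t : 0 < a -> a < 1 -> 0 < t ->
  t `^ a <= (2 `^ (1 - a)^-1) `^ a + t / 2.
Proof.
move=> a0 a1 t0; set T := 2 `^ (1 - a)^-1.
have T0 : 0 < T by rewrite powR_gt0.
have [tT|Tt] := leP t T.
  rewrite (@le_trans _ _ (T `^ a))//; last by rewrite lerDl divr_ge0// ltW.
  by apply: ge0_ler_powR; rewrite ?nnegrE// ltW.
rewrite (@le_trans _ _ (t / 2))//; last by rewrite lerDr powR_ge0.
have -> : t `^ a = t / (t `^ (1 - a)).
  rewrite -powRN -{2}(powRr1 (ltW t0)) -powRD ?(gt_eqF t0) ?implybT//.
  by congr powR; ring.
rewrite ler_pM2l// lef_pV2 ?posrE ?powR_gt0//.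
have -> : 2 = T `^ (1 - a) :> K.
  by rewrite /T -powRrM mulVf ?powRr1//; lra.
by apply: ge0_ler_powR; rewrite ?nnegrE ?ltW//; lra.
Qed.
End exp_bounds.

(** * The series of Gamma values *)

Section gamma_series.
Context {K : realType}.
Implicit Types (t s a z : K) (n k : nat).
Local Notation mu := lebesgue_measure.
Local Notation Rpos := (`]0, +oo[%classic : set K).

Lemma integrable_expR_half :
  mu.-integrable Rpos (EFin \o (fun t => expR (- (t / 2)))).
Proof.
have : mu.-integrable Rpos (EFin \o (fun t => 2 * exponential_pdf (2^-1) t)).
  have /integrable_exponential_pdf h : 0 < 2^-1 :> K by rewrite invr_gt0.
  apply: (integrableS measurableT) => //.
  exact: (integrableZl measurableT 2 h).
apply: eq_integrable => // t; rewrite inE/= in_itv/= andbT => t0.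
rewrite exponential_pdfE ?ltW// mulrA mulfV// mul1r; congr (expR _)%:E.
by rewrite mulNr mulrC.
Qed.

(** All the integrands below are dominated by a multiple of exp (- t / 2): half
    of the exponential decay is kept, the other half absorbs the powers of t. *)
Lemma integrable_le_expR_half (f : K -> K) C : measurable_fun Rpos f ->
  (forall t, 0 < t -> `|f t| <= C * expR (- (t / 2))) ->
  mu.-integrable Rpos (EFin \o f).
Proof.
move=> mf fC.
have ig : mu.-integrable Rpos (fun t => C%:E * (expR (- (t / 2)))%:E)%E.
  by apply: integrableZl => //; exact: integrable_expR_half.
apply: le_integrable ig => //.
- exact/measurable_EFinP.
- move=> t /=; rewrite in_itv/= andbT => t0.
  by rewrite lee_fin (le_trans (fC t t0))// ler_norm.
Qed.

Lemma integrable_Gamma s : 0 <= s ->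
  mu.-integrable Rpos (EFin \o (fun t => t `^ s * expR (- t))).
Proof.
move=> s0; apply: (@integrable_le_expR_half _ ((2 * (s + 1)) `^ s)).
  apply: measurable_funM; first exact: measurable_funTS.
  by apply: measurableT_comp => //; exact: measurable_funTS.
move=> t t0; rewrite ger0_norm ?mulr_ge0 ?powR_ge0 ?expR_ge0//.
have -> : - (t / 2) = t / 2 - t by lra.
by rewrite expRD mulrA ler_wpM2r ?expR_ge0// powR_le_expR.
Qed.

Lemma integrable_expR_powRB a : 0 < a -> a < 1 ->
  mu.-integrable Rpos (EFin \o (fun t => expR (t `^ a) * expR (- t))).
Proof.
move=> a0 a1.
apply: (@integrable_le_expR_half _ (expR ((2 `^ (1 - a)^-1) `^ a))).
  apply: measurable_funM.
    by apply: measurableT_comp => //; exact: measurable_funTS.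
  by apply: measurableT_comp => //; exact: measurable_funTS.
move=> t t0; rewrite ger0_norm ?mulr_ge0 ?expR_ge0//.
rewrite -!expRD ler_expR.
have := powR_le_half a0 a1 t0; lra.
Qed.

Lemma integrable_expRN_powR a :
  mu.-integrable Rpos (EFin \o (fun t => expR (- t `^ a) * expR (- t))).
Proof.
apply: (@integrable_le_expR_half _ 1).
  apply: measurable_funM.
    do 2 apply: measurableT_comp => //.
    exact: measurable_funTS.
  by apply: measurableT_comp => //; exact: measurable_funTS.
move=> t t0; rewrite ger0_norm ?mulr_ge0 ?expR_ge0//.
rewrite -!expRD mul1r ler_expR.
have := powR_ge0 t a; lra.
Qed.

(** The parameter z is - 1 for the series itself and 1 for the series of its
    absolute values. *)
Lemma integral_Gamma_term (c1 c2 z : K) k : 0 < c1 -> 0 < c2 ->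
  mu.-integrable Rpos
    (EFin \o (fun t => (z * t `^ (c2 / c1)) ^+ k / k`!%:R * expR (- t))) /\
  \int[mu]_(t in Rpos) ((z * t `^ (c2 / c1)) ^+ k / k`!%:R * expR (- t)) =
  z ^+ k / k`!%:R * Gamma (k%:R * c2 / c1 + 1).
Proof.
move=> c10 c20.
have s0 : 0 <= k%:R * c2 / c1 by rewrite divr_ge0 ?mulr_ge0// ltW.
have E t : (z * t `^ (c2 / c1)) ^+ k / k`!%:R * expR (- t) =
    z ^+ k / k`!%:R * (t `^ (k%:R * c2 / c1 + 1 - 1) * expR (- t)).
  rewrite addrK (_ : k%:R * c2 / c1 = c2 / c1 * k%:R); last by ring.
  rewrite (powRrM _ _ k%:R) powR_mulrn ?powR_ge0// exprMn; ring.
have iG := integrable_Gamma s0.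
rewrite -[k%:R * c2 / c1](addrK 1) in iG.
split.
  have -> : (fun t => (z * t `^ (c2 / c1)) ^+ k / k`!%:R * expR (- t)) =
    (fun t => z ^+ k / k`!%:R * (t `^ (k%:R * c2 / c1 + 1 - 1) * expR (- t))).
    exact/funext.
  by apply: (integrableZl _ _ iG).
under eq_Rintegral do rewrite E.
by rewrite RintegralZl.
Qed.

Lemma integral_Gamma_sum (c1 c2 z : K) n : 0 < c1 -> 0 < c2 ->
  mu.-integrable Rpos
    (EFin \o (fun t =>
      (\sum_(k < n) (z * t `^ (c2 / c1)) ^+ k / k`!%:R) * expR (- t))) /\
  \int[mu]_(t in Rpos)
    ((\sum_(k < n) (z * t `^ (c2 / c1)) ^+ k / k`!%:R) * expR (- t)) =
  \sum_(k < n) z ^+ k / k`!%:R * Gamma (k%:R * c2 / c1 + 1).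
Proof.
move=> c10 c20; elim: n => [|n [IHi IHs]].
  rewrite big_ord0.
  have -> : (fun t =>
      (\sum_(k < 0) (z * t `^ (c2 / c1)) ^+ k / k`!%:R) * expR (- t)) = cst 0.
    by apply/funext => t; rewrite big_ord0 mul0r.
  by split; [exact: integrable0|rewrite /Rintegral integral0].
have [iT eT] := integral_Gamma_term z n c10 c20.
have -> : (fun t =>
    (\sum_(k < n.+1) (z * t `^ (c2 / c1)) ^+ k / k`!%:R) * expR (- t)) =
  (fun t => (\sum_(k < n) (z * t `^ (c2 / c1)) ^+ k / k`!%:R) * expR (- t) +
       (z * t `^ (c2 / c1)) ^+ n / n`!%:R * expR (- t)).
  by apply/funext => t; rewrite big_ord_recr mulrDl.
split; first exact: integrableD IHi iT.
by rewrite RintegralD// IHs eT big_ord_recr.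
Qed.

(** The alternation of the remainders of exp (- x) at x = t ^ (c2 / c1),
    integrated against exp (- t). *)
Lemma alternating_Gamma_series (c1 c2 : K) n : 0 < c1 -> 0 < c2 ->
  0 <= (-1) ^+ n *
    (\int[mu]_(t in Rpos) (expR (- t `^ (c2 / c1)) * expR (- t)) -
     series (reliability_term c1 c2) n).
Proof.
move=> c10 c20.
have [iS eS] := integral_Gamma_sum (-1) n c10 c20.
rewrite /series/= big_mkord -eS -RintegralB//; last exact: integrable_expRN_powR.
rewrite -RintegralZl//; last first.
  exact: integrableB (integrable_expRN_powR _) iS.
apply: Rintegral_ge0 => t _.
under eq_bigr do rewrite mulN1r.
by rewrite -mulrBl mulrA mulr_ge0 ?expR_ge0// alternating_expRN// powR_ge0.
Qed.

(** Partial sums with an even number of terms are at most Q, those with an odd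
    number at least Q, so a common limit of the two subsequences can only be Q. *)
Lemma lim_Gamma_series (c1 c2 : K) : 0 < c1 -> 0 < c2 ->
  cvgn (series (reliability_term c1 c2)) ->
  limn (series (reliability_term c1 c2)) =
  \int[mu]_(t in Rpos) (expR (- t `^ (c2 / c1)) * expR (- t)).
Proof.
move=> c10 c20 cv; set L := limn _; set Q := RHS.
have alt n := alternating_Gamma_series n c10 c20.
have cvb b : series (reliability_term c1 c2) (n.*2 + b)%N @[n --> \oo] --> L.
  apply: (@cvg_comp _ _ _ (fun n => (n.*2 + b)%N) _ _ \oo); last exact: cv.
  apply/cvgnyPge => m; near=> n.
  rewrite (@leq_trans n)//; first by near: n; exact: nbhs_infty_ge.
  by rewrite -addnn -addnA leq_addr.
apply/eqP; rewrite eq_le; apply/andP; split.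
  apply: (cvgr_to_le (cvb 0%N)); near=> n.
  have := alt (n.*2 + 0)%N.
  by rewrite addn0 -signr_odd odd_double mul1r subr_ge0.
apply: (cvgr_to_ge (cvb 1%N)); near=> n.
have := alt (n.*2 + 1)%N.
by rewrite addn1 -signr_odd /= odd_double mulN1r oppr_ge0 subr_le0.
Unshelve. all: by end_near. Qed.

(** The partial sums of the absolute values are integrals of truncations of the
    series of exp (t ^ (c2 / c1)), against exp (- t); the full integrand is
    integrable because the exponent c2 / c1 is less than 1. *)
Lemma cvg_Gamma_series (c1 c2 : K) : 0 < c2 -> c2 < c1 ->
  cvgn (series (reliability_term c1 c2)).
Proof.
move=> c20 c21; have c10 := lt_trans c20 c21.
have a0 : 0 < c2 / c1 by rewrite divr_gt0.
have a1 : c2 / c1 < 1 by rewrite ltr_pdivrMr// mul1r.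
apply: normed_cvg; apply: nondecreasing_is_cvgn.
  by apply: nondecreasing_series => *; exact: normr_ge0.
exists (\int[mu]_(t in Rpos) (expR (t `^ (c2 / c1)) * expR (- t))).
move=> _ [n _ <-].
have [iS eS] := integral_Gamma_sum 1 n c10 c20.
rewrite [leLHS](_ : _ =
  \sum_(k < n) 1 ^+ k / k`!%:R * Gamma (k%:R * c2 / c1 + 1)); last first.
  transitivity (\sum_(0 <= k < n) `|reliability_term c1 c2 k|); first by [].
  rewrite big_mkord; apply: eq_bigr => k _.
  rewrite /reliability_term normrM normrM normrX normrN1 ger0_norm ?invr_ge0//.
  rewrite ger0_norm//; apply: Rintegral_ge0 => t _.
  by rewrite mulr_ge0 ?powR_ge0 ?expR_ge0.
rewrite -eS; apply: le_Rintegral => //; first exact: integrable_expR_powRB.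
move=> t _; rewrite ler_wpM2r ?expR_ge0//.
under eq_bigr do rewrite mul1r.
have -> : \sum_(k < n) (t `^ (c2 / c1)) ^+ k / k`!%:R =
  series (exp_coeff (t `^ (c2 / c1))) n.
  by rewrite /series/= big_mkord.
apply: nondecreasing_cvgn_le; last exact: is_cvg_series_exp_coeff.
by apply: nondecreasing_series => k _ _; exact/exp_coeff_ge0/powR_ge0.
Qed.

End gamma_series.

(** * Comparing two independent random variables *)

Section joint_law.
Context d (T : measurableType d) (K : realType) (P : probability T K).
Variables X Y : {RV P >-> K}.
Local Open Scope ereal_scope.

(** Independence fixes the joint law on rectangles, which determine it. *)
Lemma independent_RV_joint (A : set (K * K)) :
  independent_RV X Y -> measurable A ->
  P [set w | A (X w, Y w)] = (distribution P X \x distribution P Y) A.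
Proof.
move=> XY mA.
have mZ : measurable_fun setT (fun w => (X w, Y w)).
  exact: measurable_fun_pair.
pose Z : {mfun T >-> (K * K)%type} := mfun_Sub (mem_set mZ).
rewrite (@product_measure_unique _ _ _ _ _ _ _ (distribution P Z)) //.
Qed.

(** Tonelli on the product law.  The section above x of the set p.1 <= p.2 is the
    closed ray [x, +oo[, and the atomlessness of Y allows dropping its end
    point. *)
Lemma probability_le_ccdf :
  independent_RV X Y -> (forall x, distribution P Y [set x] = 0) ->
  P [set w | (X w <= Y w)%R] = \int[P]_w ccdf Y (X w).
Proof.
move=> XY Y0.
have mA : measurable [set p : K * K | (p.1 <= p.2)%R].
  by rewrite -[X in measurable X]setTI; exact: measurable_fun_le.
rewrite (independent_RV_joint XY mA).
rewrite -(@ge0_integral_distribution _ _ _ _ _ P X (ccdf Y))//; last first.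
  exact: ccdf_measurable.
apply: eq_integral => x _ /=.
have -> : xsection [set p : K * K | (p.1 <= p.2)%R] x =
    [set x] `|` `]x, +oo[%classic.
  apply/seteqP; split => y; rewrite /xsection/= inE/=.
    rewrite le_eqVlt => /predU1P[->|xy]; first by left.
    by right; rewrite /= in_itv/= xy.
  by case=> [->//|/=]; rewrite in_itv/= andbT => /ltW.
transitivity (distribution P Y [set x] + ccdf Y x); last by rewrite Y0 add0e.
rewrite /ccdf -measureU//.
by apply/seteqP; split => // y [/= ->]; rewrite in_itv/= ltxx.
Qed.

End joint_law.

(** * The probability integral transform *)

Section probability_integral_transform.
Context d (T : measurableType d) (K : realType) (P : probability T K).
Variables X : {RV P >-> K}.

Definition cdf_transform (w : T) : K := fine (cdf X (X w)).

Lemma measurable_cdf_transform : measurable_fun setT cdf_transform.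
Proof.
apply: (measurableT_comp (f := fine)); first exact: fine_measurable.
by apply: measurableT_comp => //; exact: cdf_measurable.
Qed.

HB.instance Definition _ :=
  isMeasurableFun.Build _ _ _ _ cdf_transform measurable_cdf_transform.

Lemma cdf_transform_le (w : T) (u : K) :
  (cdf_transform w <= u) = (cdf X (X w) <= u%:E)%E.
Proof. by rewrite -lee_fin fineK// fin_num_measure. Qed.

(** The set where the cdf is at most u is a ray ]-oo, s] with s its supremum: the
    mass of ]-oo, s[ is at most u by continuity from below, s itself has no
    mass, and right continuity gives cdf X s >= u. *)
Lemma cdf_cdf_transform (u : K) :
  (forall x, distribution P X [set x] = 0%E) -> 0 <= u -> u < 1 ->
  cdf (cdf_transform : {RV P >-> K}) u = u%:E.
Proof.
move=> X0 u0 u1.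
pose D := [set x | (cdf X x <= u%:E)%E].
have -> : cdf (cdf_transform : {RV P >-> K}) u = distribution P X D.
  rewrite /cdf /distribution /pushforward; congr (P _).
  by apply/seteqP; split => w /=; rewrite in_itv/= cdf_transform_le.
(* The set D can be empty only for u = 0, when the cdf vanishes nowhere. *)
have [D0|/set0P [x0 Dx0]] := eqVneq D set0.
  rewrite D0 measure0.
  apply/eqP; rewrite eq_le lee_fin u0/=.
  apply: (cvge_to_ge (cvg_cdfNy0 X)); apply: nearW => x.
  rewrite leNgt; apply/negP => /ltW Dx.
  by have : D x := Dx; rewrite D0.
have [M HM] : exists M, forall x, D x -> x <= M.
  apply: contrapT => /forallNP nM.
  suff : (1 <= u%:E)%E by rewrite lee_fin leNgt u1.
  apply: (cvge_to_le (cvg_cdfy1 X)); apply: nearW => M.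
  have /existsNP[x /not_implyP[Dx /negP]] := nM M.
  by rewrite -ltNge => /ltW Mx; exact: le_trans (cdf_nondecreasing X Mx) Dx.
have supD : has_sup D by split; [exists x0|exists M].
pose s := sup D.
have Ds x : D x -> x <= s by move=> Dx; exact: sup_upper_bound.
have sD x : x < s -> D x.
  rewrite -subr_gt0 => sx; have [y Dy] := sup_adherent sx supD.
  rewrite subKr => /ltW xy.
  exact: le_trans (cdf_nondecreasing X xy) Dy.
have lt_s : (distribution P X `]-oo, s[ <= u%:E)%E.
  have E : `]-oo, s[%classic = \bigcup_n `]-oo, (s - n.+1%:R^-1)]%classic.
    rewrite -setCitvr itvcyEbigcap setC_bigcap.
    by apply: eq_bigcupr => n _; rewrite setCitvr.
  rewrite E.
  have cvF : cdf X (s - n.+1%:R^-1) @[n --> \oo] -->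
      distribution P X (\bigcup_n `]-oo, (s - n.+1%:R^-1)]%classic).
    apply: (@nondecreasing_cvg_mu _ _ _ (distribution P X)) => //.
      exact: bigcup_measurable.
    move=> m n mn; apply/subsetPset; apply: subset_itvl.
    by rewrite bnd_simp lerB// lef_pV2 ?posrE// ler_nat.
  apply: (cvge_to_le cvF); apply: nearW => n; apply: sD.
  by rewrite ltrBlDr ltrDl.
have Ps : cdf X s = distribution P X `]-oo, s[.
  rewrite /cdf -(setUitv1 true)//.
  transitivity (distribution P X `]-oo, s[ + distribution P X [set s])%E.
    rewrite -measureU//.
    by apply/seteqP; split => // x /= [+ xs]; rewrite xs in_itv/= ltxx.
  by rewrite X0 adde0.
have DsE : D = `]-oo, s]%classic.
  apply/seteqP; split => x; rewrite /= in_itv/=; first exact: Ds.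
  by rewrite le_eqVlt => /predU1P[->|/sD//]; rewrite /D/= Ps.
rewrite DsE -/(cdf X s); apply/eqP; rewrite eq_le {1}Ps lt_s/=.
apply: (cvge_to_ge (@cdf_right_continuous _ _ _ _ X s)).
near=> r; rewrite leNgt; apply/negP => /ltW Dr.
have : r <= s by exact: Ds.
by rewrite leNgt => /negP; apply; near: r; exact: nbhs_right_gt.
Unshelve. all: by end_near. Qed.
Lemma cdf_cdf_transform_lt0 (u : K) : u < 0 ->
  cdf (cdf_transform : {RV P >-> K}) u = 0%E.
Proof.
move=> u0; rewrite -(measure0 P); congr (P _).
apply/seteqP; split => // w /=; rewrite in_itv/= leNgt => /negP; apply.
by rewrite (lt_le_trans u0)// fine_ge0.
Qed.

Lemma cdf_cdf_transform_ge1 (u : K) : 1 <= u ->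
  cdf (cdf_transform : {RV P >-> K}) u = 1%E.
Proof.
move=> u1; rewrite -(probability_setT P); congr (P _).
apply/seteqP; split => // w _ /=; rewrite in_itv/= cdf_transform_le.
by rewrite (le_trans (cdf_le1 X _))// lee_fin.
Qed.

End probability_integral_transform.

Section same_law.
Context d1 (T1 : measurableType d1) d2 (T2 : measurableType d2) (K : realType).
Context (P1 : probability T1 K) (P2 : probability T2 K).
Local Open Scope ereal_scope.

Lemma eq_cdf_distribution (X : {RV P1 >-> K}) (Y : {RV P2 >-> K}) :
  cdf X =1 cdf Y ->
  forall A, measurable A -> distribution P1 X A = distribution P2 Y A.
Proof.
move=> XY A mA.
apply: (measure_unique (@RGenOInfty.G K)
  (fun n => `](- n%:R)%R, +oo[%classic)) => //.
- exact: RGenOInfty.measurableE.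
- move=> _ _ [x ->] [y ->]; exists (Num.max x y).
  apply/seteqP; split => z /=; rewrite !in_itv/= !andbT gt_max.
    by move=> [-> ->].
  by move=> /andP.
- by move=> n; exists (- n%:R)%R.
- rewrite -subTset => z _; exists (Num.bound `|z|) => //=.
  rewrite in_itv/= andbT ltrNl (le_lt_trans _ (archi_boundP (normr_ge0 z)))//.
  by rewrite -normrN ler_norm.
- move=> _ [x ->].
  transitivity (ccdf X x) => //; transitivity (ccdf Y x) => //.
  by rewrite !ccdf_1_cdf XY.
- by move=> n; rewrite -ge0_fin_numE// fin_num_measure.
Qed.

(** Both transforms are uniform on [0, 1]; this is what transports an expectation
    from one atomless variable to another. *)
Lemma cdf_transform_same_law (X : {RV P1 >-> K}) (Y : {RV P2 >-> K}) :
  (forall x, distribution P1 X [set x] = 0) ->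
  (forall x, distribution P2 Y [set x] = 0) ->
  forall A, measurable A ->
  distribution P1 (cdf_transform X) A = distribution P2 (cdf_transform Y) A.
Proof.
move=> X0 Y0; apply: eq_cdf_distribution => u.
have [u0|u0] := ltP u 0%R; first by rewrite !cdf_cdf_transform_lt0.
have [u1|u1] := ltP u 1%R; first by rewrite !cdf_cdf_transform.
by rewrite !cdf_cdf_transform_ge1.
Qed.

Lemma integral_cdf_transform (X : {RV P1 >-> K}) (Y : {RV P2 >-> K})
    (f : K -> \bar K) :
  (forall x, distribution P1 X [set x] = 0) ->
  (forall x, distribution P2 Y [set x] = 0) ->
  measurable_fun setT f -> (forall u, 0 <= f u) ->
  \int[P1]_w f (cdf_transform X w) = \int[P2]_w f (cdf_transform Y w).
Proof.
move=> X0 Y0 mf f0.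
rewrite -(@ge0_integral_distribution _ _ _ _ _ P1 (cdf_transform X) f)//.
rewrite -(@ge0_integral_distribution _ _ _ _ _ P2 (cdf_transform Y) f)//.
apply: eq_measure_integral => A mA _; exact: cdf_transform_same_law.
Qed.

End same_law.

Lemma has_pdf_no_atom d (T : measurableType d) (K : realType)
    (P : probability T K) (X : {RV P >-> K}) f :
  has_pdf X f -> forall x, distribution P X [set x] = 0%E.
Proof. by case=> _ _ Xf x; rewrite Xf// integral_set1. Qed.

(** * The standard exponential distribution *)

Section exponential.
Context {K : realType}.
Local Notation mu := (@lebesgue_measure K).
Local Open Scope ereal_scope.

(** A proof that the rate is positive is an argument of the probability structure
    on [exponential_prob]. *)
Definition std_exponential : probability (measurableTypeR K) K.
Proof.
refine (exponential_prob (1%R : K) : probability (measurableTypeR K) K).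
exact: ltr01.
Defined.

Lemma std_exponential_dom : std_exponential `<< mu.
Proof.
apply/null_content_dominatesP => A mA A0.
apply: null_set_integral => //.
apply: measurable_funTS; apply/measurable_EFinP.
exact: measurable_exponential_pdf.
Qed.

(** The density exp (- t) is almost everywhere the Radon-Nikodym derivative.  The
    bound by 1 makes f integrable for the exponential law. *)
Lemma integral_std_exponential (f : K -> \bar K) :
  measurable_fun [set: measurableTypeR K] f -> (forall x, 0 <= f x <= 1) ->
  \int[std_exponential]_x f x =
  \int[mu]_(x in `]0%R, +oo[) (f x * (expR (- x))%:E).
Proof.
move=> mf f01.
have intf : std_exponential.-integrable setT f.
  apply: (@le_integrable _ _ _ _ _ _ _ (cst 1)) => //.
    by move=> x _ /=; have /andP[f0 f1] := f01 x; rewrite gee0_abs// normr1.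
  by apply: finite_measure_integrable_cst.
rewrite -(Radon_Nikodym_change_of_variables
  std_exponential_dom measurableT intf).
transitivity (\int[mu]_x (f x * (exponential_pdf 1 x)%:E)).
  apply: ae_eq_integral => //.
  - apply: emeasurable_funM => //; apply: (measurable_int mu).
    by apply: Radon_Nikodym_integrable; exact: std_exponential_dom.
  - apply: emeasurable_funM => //; apply/measurable_EFinP.
    exact: measurable_exponential_pdf.
  - apply: ae_eqe_mul2l => /=.
    rewrite Radon_NikodymE//=; first exact: std_exponential_dom.
    move=> dom; case: cid => /= h [h1 h2 h3].
    (* Two densities of the same measure agree almost everywhere. *)
    apply: integral_ae_eq => //=.
    + by apply/measurable_EFinP; exact: measurable_exponential_pdf.
    + by move=> E _ mE; rewrite -h3.
rewrite [LHS](_ : _ =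
  \int[mu]_(x in `[0%R, +oo[) (f x * (expR (- x))%:E)); last first.
  rewrite [RHS]integral_mkcond; apply: eq_integral => x _.
  rewrite /exponential_pdf !patchE; case: ifP => _; last by rewrite mule0.
  by rewrite mul1r mulN1r.
rewrite -integral_itv_obnd_cbnd//; apply: measurable_funTS.
apply: emeasurable_funM => //; apply/measurable_EFinP.
exact: measurableT_comp.
Qed.
End exponential.

Section exponential_rv.
Context {K : realType}.
Local Notation nu := (@std_exponential K).
Local Open Scope ereal_scope.

(** The identity, made a random variable so that the results on [cdf] and
    [cdf_transform] apply to the exponential law. *)
Definition exponential_RV : measurableTypeR K -> K := idfun.

HB.instance Definition _ := @isMeasurableFun.Build _ _ _ _ exponential_RV
  (@measurable_id _ (measurableTypeR K) setT).

Lemma exponential_RV_no_atom x :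
  distribution nu (exponential_RV : {RV nu >-> K}) [set x] = 0.
Proof. exact: integral_set1. Qed.

(** The density vanishes on ]-oo, 0[, so the mass of ]-oo, t] is that of
    [0, t]. *)
Lemma cdf_exponential_RV t : (0 < t)%R ->
  cdf (exponential_RV : {RV nu >-> K}) t = (1 - expR (- t))%:E.
Proof.
move=> t0; rewrite EFinB -[X in expR X]mulN1r -exponential_prob_itv0c//.
transitivity (exponential_prob 1 `]-oo, t]); first by [].
rewrite /exponential_prob [LHS]integral_mkcond [RHS]integral_mkcond.
apply: eq_integral => x _; rewrite !patchE !mem_setE !in_itv/=.
have [x0|x0] := leP 0%R x; first by [].
by rewrite lt0_exponential_pdf//; case: ifP.
Qed.

Lemma cdf_transform_exponential t : (0 < t)%R ->
  cdf_transform (exponential_RV : {RV nu >-> K}) t = (1 - expR (- t))%R.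
Proof. by move=> /cdf_exponential_RV /(congr1 fine). Qed.

End exponential_rv.

(** * Two Weibull-R survival functions with the same baseline *)

Section weibull_comparison.
Context {K : realType}.
Implicit Types a c g u t : K.

(** If u is the value of a cdf and 1 - u = exp (- s), this is exp (- s ^ a); the
    value 0 for u >= 1 is the limit s = +oo, which the convention ln 0 = 0 would
    miss. *)
Definition survival_power a u : K :=
  if u < 1 then expR (- (- ln (1 - u)) `^ a) else 0.

Lemma measurable_survival_power a : measurable_fun setT (survival_power a).
Proof.
apply: measurable_fun_ifT => //.
  exact: measurable_fun_ltr.
have m1 : measurable_fun setT (fun u : K => - ln (1 - u)).
  apply: measurableT_comp => //; apply: measurableT_comp => //.
  exact: measurable_funB.
apply: measurableT_comp => //; apply: measurableT_comp => //.
exact: measurableT_comp (measurable_powR a) m1.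
Qed.

Lemma survival_power_ge0 a u : 0 <= survival_power a u.
Proof. by rewrite /survival_power; case: ifP => // _; exact: expR_ge0. Qed.

Lemma survival_power_le1 a u : survival_power a u <= 1.
Proof.
rewrite /survival_power; case: ifP => // _.
by rewrite expR_le1 oppr_le0 powR_ge0.
Qed.

Lemma survival_power_expRN a s : 
  survival_power a (1 - expR (- s)) = expR (- s `^ a).
Proof.
by rewrite /survival_power gtrBl expR_gt0 subKr expRK opprK.
Qed.

(** With h the rescaled cumulative hazard, (h ^ c1) ^ (c2 / c1) = h ^ c2; the case
    h = +oo, where both survival functions vanish, is covered by the value 0 of
    [survival_power]. *)
Lemma weibullR_survival_power c1 c2 g (FR : K -> \bar K) x :
  0 < c1 -> 0 < c2 -> 0 < g -> (0 <= FR x)%E -> (FR x <= 1)%E ->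
  (1 - weibullR_cdf c2 g FR x)%E =
  (survival_power (c2 / c1) (fine (weibullR_cdf c1 g FR x)))%:E.
Proof.
move=> c10 c20 g0 F0 F1.
have : (0 <= cumhaz FR x / g%:E)%E.
  rewrite mule_ge0//; last by rewrite inver gt_eqF// lee_fin invr_ge0 ltW.
  by rewrite /cumhaz leeNr oppe0 lne_le0 -[leRHS]adde0 leeD2l// leeNl oppe0.
rewrite /weibullR_cdf; case: (cumhaz FR x / g%:E)%E => [r r0|_|//].
  rewrite !poweR_EFin -EFinN /= survival_power_expRN -EFinD subKr.
  by rewrite -powRrM mulrC divfK ?gt_eqF.
by rewrite !poweRyr ?gt_eqF//= subr0 /survival_power ltxx -EFinD subrr.
Qed.

End weibull_comparison.

(** * The reliability parameter *)

Theorem theorem2 (K : realType)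
  (d0 : measure_display) (T0 : measurableType d0) (P0 : probability T0 K)
  (R : {RV P0 >-> K}) (fR : K -> K)
  (d : measure_display) (T : measurableType d) (P : probability T K)
  (X Y : {RV P >-> K}) (c1 c2 gamma : K) :
  has_pdf R (EFin \o fR) ->
  0 < c1 -> 0 < c2 -> 0 < gamma ->
  is_weibullR c1 gamma X (cdf R) fR ->
  is_weibullR c2 gamma Y (cdf R) fR ->
  independent_RV X Y ->
  (c2 < c1 -> cvgn (series (reliability_term c1 c2))) /\
  (cvgn (series (reliability_term c1 c2)) ->
   P [set w | Y w < X w] =
     (1 - limn (series (reliability_term c1 c2)))%:E).
Proof.
move=> _ c10 c20 g0 [FX /has_pdf_no_atom X0] [FY /has_pdf_no_atom Y0] XY.
split=> [|cv]; first exact: cvg_Gamma_series.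
pose a := c2 / c1.
have mXY : measurable [set w | X w <= Y w].
  by rewrite -[X in measurable X]setTI; exact: measurable_fun_le.
suff PXY : P [set w | X w <= Y w] = (limn (series (reliability_term c1 c2)))%:E.
  have -> : [set w | Y w < X w] = ~` [set w | X w <= Y w].
    by apply/seteqP; split => w /=; rewrite ltNge => /negP.
  by rewrite probability_setC// PXY.
rewrite (probability_le_ccdf XY Y0).
have ccdfY w : ccdf Y (X w) = (survival_power a (cdf_transform X w))%:E.
  have := weibullR_survival_power c10 c20 g0
    (cdf_ge0 R (X w)) (cdf_le1 R (X w)).
  by rewrite -FX -FY -ccdf_1_cdf.
under eq_integral do rewrite ccdfY.
rewrite (integral_cdf_transform X0 exponential_RV_no_atom
  (f := fun u => (survival_power a u)%:E)); first last.
- by move=> u; rewrite lee_fin survival_power_ge0.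
- apply/measurable_EFinP; exact: measurable_survival_power.
rewrite (integral_std_exponential
  (f := fun t => (survival_power a (cdf_transform exponential_RV t))%:E)); first last.
- by move=> t; rewrite !lee_fin survival_power_ge0 survival_power_le1.
- apply/measurable_EFinP; apply: measurableT_comp => //.
  exact: measurable_survival_power.
rewrite lim_Gamma_series// /Rintegral fineK; last first.
  exact/integrable_fin_num/integrable_expRN_powR.
apply: eq_integral => t; rewrite inE/= in_itv/= andbT => t0.
by rewrite cdf_transform_exponential// survival_power_expRN.
Qed.
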